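(* (i) Let $n$ be an integer such that $n=3$ or $n=5$ or $n\ge7$. Then there exists an $n$-state automaton over the alphabet $\{0,1\}$ that defines a free transformation group on $n$ generators. (ii) For any integer $n\ge3$ there exists an $n$-state automaton over the alphabet $\{0,1\}$ that defines a transformation group freely generated by $n$ involutions.
   Context: An automaton is a quadruple $(Q,X,\phi,\psi)$ with nonempty sets $Q$ (internal states) and $X$ (finite alphabet), a state transition function $\phi:Q\times X\to Q$ and an output function $\psi:Q\times X\to X$. It is an $n$-state automaton if $|Q|=n$. Let $X^*$ be the set of finite words over $X$ (including the empty word). For an automaton $Y=(Q,X,\phi,\psi)$ and $q\in Q$, the transformation $Y_q:X^*\to X^*$ is defined recursively by $Y_q(\varnothing)=\varnothing$ and $Y_q(xw)=\psi(q,x)\,Y_{\phi(q,x)}(w)$ for $x\in X$, $w\in X^*$. $Y$ is invertible if all $Y_q$, $q\in Q$, are bijective; then the transformation group defined by $Y$ is the group $G(Y)$ of transformations of $X^*$ generated (under composition) by $Y_q$, $q\in Q$. A group is freely generated by $n$ involutions $g_1,\dots,g_n$ if each $g_i$ has order $2$ and the group is the free product of its $n$ order-$2$ subgroups $\langle g_i\rangle$. *)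

(* Defs.v *)
From HB Require Import structures.
From mathcomp Require Import all_boot.
From mathcomp Require Import boolp classical_sets.

Set Implicit Arguments.
Unset Strict Implicit.
Unset Printing Implicit Defensive.

Local Open Scope classical_set_scope.
Local Open Scope group_scope.

(* The group of all bijective transformations of a type.  The inverse is stored
   as data; it is determined by the function, so equality of bijections is
   pointwise equality (bij_ext).  The product f * g is f \o g. *)

Record bijection (T : Type) := Bijection {
  bij_fun :> T -> T;
  bij_inv : T -> T;
  bij_funK : cancel bij_fun bij_inv;
  bij_invK : cancel bij_inv bij_fun
}.

Lemma bij_ext (T : Type) (f g : bijection T) : f =1 g -> f = g.
Proof.
case: f g => [f f' fK f'K] [g g' gK g'K] /= /funext efg.
rewrite {f}efg in fK f'K *.
have efg' : f' = g' by apply: funext => x; rewrite -{1}[x]g'K fK.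
rewrite {f'}efg' in fK f'K *.
by rewrite (Prop_irrelevance fK gK) (Prop_irrelevance f'K g'K).
Qed.

Section BijectionGroup.
Variable T : Type.
Implicit Types f g h : bijection T.

Definition bij_one : bijection T :=
  @Bijection T id id (fun=> erefl) (fun=> erefl).

Definition bij_mul f g : bijection T :=
  Bijection (can_comp (@bij_funK T f) (@bij_funK T g))
            (can_comp (@bij_invK T g) (@bij_invK T f)).

Definition bij_opp f : bijection T :=
  Bijection (@bij_invK T f) (@bij_funK T f).

Fact bij_mulA : associative bij_mul.
Proof. by move=> f g h; apply: bij_ext. Qed.

Fact bij_mul1 : left_id bij_one bij_mul.
Proof. by move=> f; apply: bij_ext. Qed.

Fact bij_mulr1 : right_id bij_one bij_mul.
Proof. by move=> f; apply: bij_ext. Qed.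

Fact bij_mulV : left_inverse bij_one bij_opp bij_mul.
Proof. by move=> f; apply: bij_ext => x /=; rewrite bij_funK. Qed.

Fact bij_mulrV : right_inverse bij_one bij_opp bij_mul.
Proof. by move=> f; apply: bij_ext => x /=; rewrite bij_invK. Qed.

HB.instance Definition _ := gen_eqMixin (bijection T).
HB.instance Definition _ := gen_choiceMixin (bijection T).
HB.instance Definition _ := isGroup.Build (bijection T)
  bij_mulA bij_mul1 bij_mulr1 bij_mulV bij_mulrV.

End BijectionGroup.

Section FreeGroups.
Variable G : groupType.
Implicit Types (A H : set G).

Definition subgroup H : Prop := group_closed (mem H).

Definition generated A : set G := smallest subgroup A.

(* The letter (i, true) stands for g i, and (i, false) for its inverse. *)
Definition letter_val (I : Type) (g : I -> G) (l : I * bool) : G :=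
  if l.2 then g l.1 else (g l.1)^-1.

Definition reduced_word (I : eqType) (w : seq (I * bool)) : bool :=
  sorted (fun a b : I * bool => ~~ ((a.1 == b.1) && (a.2 != b.2))) w.

Definition free_basis (I : eqType) H (g : I -> G) : Prop :=
  H = generated (range g) /\
  forall h, H h ->
    exists! w : seq (I * bool),
      reduced_word w /\ \prod_(l <- w) letter_val g l = h.

Definition free_on_generators H (n : nat) : Prop :=
  exists g : 'I_n -> G, free_basis H g.

(* A reduced product of elements of the subgroups K i, each factor being
   recorded together with the index of the subgroup it is taken from. *)
Definition reduced_product (I : eqType) (K : I -> set G) (s : seq (I * G)) :
    Prop :=
  {in s, forall l, K l.1 l.2 /\ l.2 <> 1} /\
  sorted (fun a b : I * G => a.1 != b.1) s.

Definition free_product (I : eqType) H (K : I -> set G) : Prop :=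
  [/\ forall i, subgroup (K i),
      H = generated (\bigcup_i K i)
    & forall h, H h ->
        exists! s : seq (I * G),
          reduced_product K s /\ \prod_(l <- s) l.2 = h].

Definition involution (g : G) : Prop := g <> 1 /\ g ^+ 2 = 1.

Definition freely_generated_by_involutions H (n : nat) : Prop :=
  exists g : 'I_n -> G,
    (forall i, involution (g i)) /\
    free_product H (fun i => generated [set g i]).

End FreeGroups.

Record automaton (Q : Type) (X : finType) := Automaton {
  states_inhabited : inhabited Q;
  alphabet_inhabited : inhabited X;
  transition : Q -> X -> Q;
  output : Q -> X -> X
}.

Section Automata.
Variables (Q : Type) (X : finType).

Fixpoint transformation (Y : automaton Q X) (q : Q) (w : seq X) : seq X :=
  if w is x :: w' then output Y q x :: transformation Y (transition Y q x) w'
  else [::].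

Definition invertible (Y : automaton Q X) : Prop :=
  forall q, bijective (transformation Y q).

(* For invertible Y every transformation Y q is (the function of) exactly one
   bijection, so that the generating set below consists of all of them. *)
Definition transformation_group (Y : automaton Q X) : set (bijection (seq X)) :=
  generated [set f : bijection (seq X) | exists q : Q, f =1 transformation Y q].

End Automata.

(* Main.v *)
Require Import Defs.
From mathcomp Require Import all_boot.
From mathcomp Require Import perm zify.
From mathcomp Require Import boolp classical_sets.

(** Let [s] be a permutation of [Q] and [a], [b], [x] distinct elements of [Q].
The automaton with state set [Q] in which the state [q] flips its input letter
iff [q = x] and moves to [s q] on [false], to [s (tperm a b q)] on [true],
defines involutions [b_q]; adjoin the involution [h] flipping all letters.  The
sections of a product [w] of these generators at the two letters are products
of the same length, and the two permutations [w |-> dual c w] of the set of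
words of a given length preserve triviality of the product.

For [s] the rotation of ['I_n], [(a, b) = (0, 1)], and [x = 3] (or [x = 2] when
[n = 3]), the group generated by the two permutations [dual c] contains all
permutations of [Q] acting letter by letter.  Therefore it also contains the
maps which apply a transposition fixing [x] to just those letters that have an
odd number of occurrences of [x] and [h] on their left.  These maps act
transitively on the words without two equal consecutive letters in which [h]
has prescribed positions.  So if one such nonempty word were trivial, then so
would be one with an odd number of letters [x] and [h], which moves the word
[false].  Hence [h] and the [b_q] freely generate a free product of groups of
order 2, in which the [h b_q] freely generate a free group.  This covers all
[n >= 3] except [n = 4], where [h] and the three [b_q] with [n = 3] are used. *)

Set Implicit Arguments.
Unset Strict Implicit.
Unset Printing Implicit Defensive.

(** * Generated subgroups *)

Section Subgroups.
Local Open Scope group_scope.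
Variable G : groupType.
Implicit Types (A H : set G).

Lemma subgroupP H :
  subgroup H <-> H 1 /\ forall x y, H x -> H y -> H (x * y^-1).
Proof.
split=> [[h1 hd]|[h1 hd]].
  split=> [|x y hx hy]; first by move: h1; rewrite inE.
  by have := hd x y; rewrite !inE; apply.
split=> [|x y]; rewrite !inE //; exact: hd.
Qed.

Lemma generated_subgroup A : subgroup (generated A).
Proof.
apply/subgroupP; split=> [H [/subgroupP [] //]|x y hx hy H HA].
by have /subgroupP[_ hd] := HA.1; apply: hd; [apply: hx|apply: hy].
Qed.

Lemma generated_sub A H :
  subgroup H -> (A `<=` H -> generated A `<=` H)%classic.
Proof. by move=> sH AH; apply: smallest_sub. Qed.

Lemma generated_gen A x : A x -> generated A x.
Proof. by move=> Ax; apply: sub_gen_smallest. Qed.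

End Subgroups.

(** * Normal forms over an alphabet with formal inverses *)

Section InvolutiveAlphabet.
Local Open Scope group_scope.
Variables (G : groupType) (L : eqType) (inv : L -> L) (val : L -> G).
Hypothesis invK : involutive inv.
Hypothesis valV : forall l, val (inv l) = (val l)^-1.

(** Here [inv] is the identity for involutions and the change of sign for free generators, so both
    notions of reduced word are instances. *)
Definition irreducible (w : seq L) := sorted (fun a b => a != inv b) w.

Lemma prod_rev_inv w :
  \prod_(l <- rev (map inv w)) val l = (\prod_(l <- w) val l)^-1.
Proof.
elim: w => [|a w IH]; first by rewrite !big_nil invg1.
by rewrite /= rev_cons -cats1 big_cat big_seq1 IH big_cons valV invgM.
Qed.

Lemma irreducible_exists w : exists2 u, irreducible u
  & \prod_(l <- u) val l = \prod_(l <- w) val l.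
Proof.
elim: w => [|a w [u ur IH]]; first by exists [::].
rewrite big_cons -IH; case: u ur {IH} => [|b u] ur.
  by exists [:: a] => //; rewrite big_cons.
have [->|ab] := eqVneq a (inv b).
  exists u; last by rewrite big_cons valV mulKg.
  exact: path_sorted ur.
exists (a :: b :: u); last by rewrite big_cons.
by rewrite /irreducible /= ab; exact: ur.
Qed.

(** The inverted word ends in [inv a], which cancels against [b] only if [a = b]. *)
Lemma irreducible_rev_inv_cat a b u v :
    irreducible (a :: u) -> irreducible (b :: v) -> a != b ->
  irreducible (rev (map inv (a :: u)) ++ b :: v).
Proof.
rewrite /irreducible /= rev_cons => au bv ab.
have: sorted (fun a b => a != inv b) (rcons (rev (map inv u)) (inv a)).
  rewrite -rev_cons rev_sorted -/(map inv (a :: u)) sorted_map /=.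
  elim: u a au {ab} => //= c u IH a /andP[ac cu].
  by rewrite invK eq_sym ac IH.
move: (rev _) => s; case: s => [|c s] /=.
  by rewrite bv andbT (inj_eq (can_inj invK)).
by rewrite cat_path last_rcons /= bv andbT (inj_eq (can_inj invK)) => ->.
Qed.

Hypothesis free : forall w,
  irreducible w -> \prod_(l <- w) val l = 1 -> w = [::].

(** Strip equal first letters; at the first difference the quotient of the two words is irreducible
    and nonempty, but has value 1. *)
Lemma irreducible_inj w w' : irreducible w -> irreducible w' ->
  \prod_(l <- w) val l = \prod_(l <- w') val l -> w = w'.
Proof.
elim: w w' => [|a u IH] [|b v] // ir ir' e.
- by symmetry; apply: free => //; rewrite -e big_nil.
- by apply: free => //; rewrite e big_nil.
have [ab|ab] := eqVneq a b.
  subst b; congr cons; apply: IH;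
    [exact: path_sorted ir|exact: path_sorted ir'|].
  by apply: (@mulgI _ (val a)); move: e; rewrite !big_cons.
have := free (irreducible_rev_inv_cat ir ir' ab).
by rewrite big_cat prod_rev_inv e /= mulVg; case: (rev _) => [|? ?] /(_ erefl).
Qed.

Lemma generated_irreducible (A : set G) h : (A `<=` range val)%classic ->
  generated A h ->
  exists! w, irreducible w /\ \prod_(l <- w) val l = h.
Proof.
move=> Aval Ah.
have [w <-] : exists w, \prod_(l <- w) val l = h.
  apply: (generated_sub (H := fun h => exists w, \prod_(l <- w) val l = h)) Ah.
    apply/subgroupP; split=> [|x y [u <-] [v <-]]; first by exists [::];
      rewrite big_nil.
    by exists (u ++ rev (map inv v)); rewrite big_cat /= prod_rev_inv.
  by move=> x /Aval[l _ <-]; exists [:: l]; rewrite big_seq1.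
have [u ur <-] := irreducible_exists w.
by exists u; split=> // v [vr e]; apply: irreducible_inj.
Qed.

End InvolutiveAlphabet.

(** * Free products of groups of order 2 *)

Section FreeProductOfInvolutions.
Local Open Scope group_scope.
Variables (G : groupType) (I : eqType) (b : I -> G).
Hypothesis bb : forall i, b i * b i = 1.
Hypothesis free : forall w, sorted (fun i j => i != j) w ->
  \prod_(i <- w) b i = 1 -> w = [::].

Let bV i : b i = (b i)^-1.
Proof. by apply/esym/mulg1_eq. Qed.

Lemma involution_neq1 i : b i <> 1.
Proof. by move=> bi1; have := @free [:: i] erefl;
  rewrite big_seq1 => /(_ bi1). Qed.

Lemma generated_involution i k :
  generated [set b i]%classic k <-> k = 1 \/ k = b i.
Proof.
split=> [|[->|->]].
- apply: (generated_sub (H := fun k => k = 1 \/ k = b i));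
  last by move=> x ->; right.
  apply/subgroupP; split=> [|x y]; first by left.
  by move=> [->|->] [->|->]; rewrite ?invg1 ?mulg1 ?mul1g -?bV ?bb; auto.
- by have /subgroupP[] := generated_subgroup [set b i]%classic.
- exact: generated_gen.
Qed.

Lemma free_product_of_involutions :
  free_product (generated (range b)) (fun i => generated [set b i]%classic).
Proof.
split=> [i||h Hh]; first exact: generated_subgroup.
  apply/seteqP; split; apply: generated_sub; try exact: generated_subgroup.
    by move=> _ [i _ <-]; apply: generated_gen; exists i => //;
      apply: generated_gen.
  move=> k [i _ /generated_involution[]->].
    by have /subgroupP[] := generated_subgroup (range b).
  by apply: generated_gen; exists i.
have [w [[wr wh] wu]] := generated_irreducible (fun i => erefl i) bV free
  (@subset_refl _ _) Hh.
exists [seq (i, b i) | i <- w]; split.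
  split; last by rewrite big_map.
  split; last by rewrite sorted_map.
  move=> _ /mapP[i _ ->] /=; split; last exact: involution_neq1.
  exact: generated_gen.
move=> s [[sK sr] sh].
(* A factor is 1 or [b i] and differs from 1, so its index determines it. *)
have sE : s = [seq (i, b i) | i <- [seq l.1 | l <- s]].
  rewrite -map_comp -[LHS]map_id;
    apply/eq_in_map => -[i k] /sK[/= /generated_involution].
  by case=> ->.
rewrite sE; congr map; apply: wu; split;
  first by rewrite /irreducible sorted_map.
by rewrite -sh [in RHS]sE !big_map.
Qed.

End FreeProductOfInvolutions.

Section Reindexing.
Local Open Scope group_scope.

Lemma freely_generated_of_free (G : groupType) (I : eqType) (b : I -> G) n
    (f : 'I_n -> I) : bijective f -> (forall i, b i * b i = 1) ->
    (forall w, sorted (fun i j => i != j) w ->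
      \prod_(i <- w) b i = 1 -> w = [::]) ->
  freely_generated_by_involutions (generated (range b)) n.
Proof.
move=> [f' fK f'K] bb free; exists (b \o f).
have free_f w : sorted (fun i j => i != j) w ->
    \prod_(i <- w) (b \o f) i = 1 -> w = [::].
  move=> rw e; apply: (inj_map (can_inj fK)); apply: free;
    last by rewrite big_map.
  by rewrite sorted_map; apply: sub_sorted rw => i j; rewrite /= (can_eq fK).
have bbf i : (b \o f) i * (b \o f) i = 1 by exact: bb.
split=> [i|].
  by split; [exact: involution_neq1 free_f i|rewrite expg2].
have -> : range b = range (b \o f).
  apply/seteqP; split=> _ [i _ <-]; last by exists (f i).
  by exists (f' i) => //=; rewrite f'K.
exact: free_product_of_involutions.
Qed.

End Reindexing.

(** * From free involutions to a free basis *)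

Section FreeBasisFromInvolutions.
Local Open Scope group_scope.
Variables (G : groupType) (I : eqType) (b : option I -> G).
Hypothesis bb : forall i, b i * b i = 1.
Hypothesis free : forall w, sorted (fun i j => i != j) w ->
  \prod_(i <- w) b i = 1 -> w = [::].

Definition mulh (w : seq (option I)) :=
  if w is None :: w' then w' else None :: w.

(* The letter (i, true) stands for h b_i and (i, false) for its inverse b_i h,
   where h is the involution with index None. *)
Fixpoint unfold_word (w : seq (I * bool)) : seq (option I) :=
  if w is (i, e) :: w' then
    if e then None :: Some i :: unfold_word w'
    else Some i :: mulh (unfold_word w')
  else [::].

Let g i := b None * b (Some i).

Lemma prod_unfold_word w :
  \prod_(l <- unfold_word w) b l = \prod_(l <- w) letter_val g l.
Proof.
have prod_mulh u : \prod_(l <- mulh u) b l = b None * \prod_(l <- u) b l.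
  by case: u => [|[i|] u]; rewrite !big_cons // mulgA bb mul1g.
have bV i : (b i)^-1 = b i by apply/mulg1_eq.
elim: w => [|[i [|]] w IH]; first by rewrite !big_nil.
  by rewrite /= !big_cons IH mulgA.
by rewrite /= !big_cons prod_mulh IH mulgA /letter_val /= /g invgM !bV.
Qed.

(** Letters [Some i] and [Some j] become adjacent only if they come from neighbours of opposite
    sign, whose indices differ in a reduced word. *)
Lemma unfold_word_sorted w : reduced_word w ->
  sorted (fun i j => i != j) (unfold_word w).
Proof.
rewrite /reduced_word; elim: w => [|[i e] w IH] //= ir.
have {IH} := IH (path_sorted ir).
case: w ir => [|[j e'] w] /=; first by case: e.
case/andP; case: e; case: e' => /=; rewrite ?andbT ?andbF //= => ij _ //.
  by move=> ->; rewrite andbT.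
by move=> ->; rewrite andbT.
Qed.

Lemma free_basis_from_involutions : free_basis (generated (range g)) g.
Proof.
split=> // h Hh.
have gV l : letter_val g (l.1, ~~ l.2) = (letter_val g l)^-1.
  by case: l => i [|]; rewrite /letter_val //= invgK.
have invK : involutive (fun l : I * bool => (l.1, ~~ l.2)).
  by case=> i e; rewrite /= negbK.
have relE : (fun l m : I * bool => ~~ ((l.1 == m.1) && (l.2 != m.2))) =2
    (fun l m => l != (m.1, ~~ m.2)).
  by case=> i e [j e']; rewrite xpair_eqE /=; case: e; case: e'.
have irE w : reduced_word w = irreducible (fun l : I * bool => (l.1, ~~ l.2)) w.
  exact: eq_sorted.
have [||w [[wr wh] wu]] := generated_irreducible invK gV _ _ Hh.
- move=> w; rewrite -irE -prod_unfold_word => /unfold_word_sorted/free/[apply].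
  by case: w => [|[i [|]] w].
- by move=> _ [i _ <-]; exists (i, true).
by exists w; split=> [|v]; rewrite irE // => ?; apply: wu.
Qed.

End FreeBasisFromInvolutions.

(** * Words in the involutions and flag-dependent substitutions *)

Section Words.
Variable Q : finType.
Implicit Types (x y z q : Q) (w : seq (option Q)).

(* The letter None stands for the involution h of the header. *)
Definition active x (l : option Q) := if l is Some q then q == x else true.

(** The flag starts at [s] and is flipped by every active input letter; [g] replaces [f] where it is
    up. Section maps and the moves of [linked] are both of this form. *)
Fixpoint toggle x (f g : Q -> Q) (s : bool) w : seq (option Q) :=
  if w is l :: w' then
    omap (if s then g else f) l :: toggle x f g (s (+) active x l) w'
  else [::].

Definition letterwise (f : Q -> Q) w := map (omap f) w.

Lemma eq_toggle x f f' g g' s w :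
  f =1 f' -> g =1 g' -> toggle x f g s w = toggle x f' g' s w.
Proof.
move=> ff gg; elim: w s => //= l w IH s; congr (_ :: _); last exact: IH.
by case: s; apply: eq_omap.
Qed.

Lemma toggle_letterwise x f s w : toggle x f f s w = letterwise f w.
Proof. by elim: w s => //= l w IH s; rewrite IH if_same. Qed.

(** The maps [f'] and [g'] send exactly the letter [y] to [x], so both passes see the same flags. *)
Lemma toggle_comp x y f g f' g' s w :
    (forall q, (f' q == x) = (q == y)) -> (forall q, (g' q == x) = (q == y)) ->
  toggle x f g s (toggle y f' g' s w) = toggle y (f \o f') (g \o g') s w.
Proof.
move=> hf hg; elim: w s => //= l w IH s; congr (_ :: _);
  first by case: s l => [] [].
rewrite -IH; congr (toggle x f g (s (+) _) _).
by case: l => //= q; case: s; rewrite ?hf ?hg.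
Qed.

Lemma letterwise_toggle x f g h s w :
  letterwise h (toggle x f g s w) = toggle x (h \o f) (h \o g) s w.
Proof. by elim: w s => //= l w IH s; rewrite IH; case: s l => [] []. Qed.

Lemma toggle_letterwise_comp x y f g h s w :
  (forall q, (h q == x) = (q == y)) ->
  toggle x f g s (letterwise h w) = toggle y (f \o h) (g \o h) s w.
Proof. by move=> hh; rewrite -(toggle_letterwise y h s) toggle_comp. Qed.

Lemma toggle_cat x f g s w w' : exists s',
  toggle x f g s (w ++ w') = toggle x f g s w ++ toggle x f g s' w'.
Proof.
by elim: w s => [|l w IH] s /=;
  [exists s|have [s' ->] := IH (s (+) active x l); exists s'].
Qed.

Lemma toggle_pattern x f g s w :
  map isSome (toggle x f g s w) = map isSome w.
Proof. by elim: w s => //= l w IH s; rewrite IH; case: l. Qed.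

Lemma letterwise_pattern f w : map isSome (letterwise f w) = map isSome w.
Proof. by rewrite -map_comp; apply: eq_map; case. Qed.

Definition reduced w := sorted (fun a b => a != b) w.

(** Neighbours are treated by different maps only after an active letter: [None] differs from its
    neighbour anyway, and at [x] the two maps agree. *)
Lemma toggle_reduced x f g s w : injective f -> injective g -> f x = g x ->
  reduced w -> reduced (toggle x f g s w).
Proof.
move=> fi gi fg; rewrite /reduced; case: w => //= l w.
elim: w l s => //= m w IH l s /andP[lm /IH] -> ; rewrite andbT.
case: l m lm => [q|] [q'|] //= qq'.
have {}qq' : q != q' by apply: contra qq' => /eqP->.
have [qx|_] := eqVneq q x; last first.
  rewrite addbF; case: s; apply: contra qq' => /eqP[]; first by move=> /gi->.
  by move=> /fi->.
rewrite qx in qq' *.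
case: s => /=; [rewrite -fg|rewrite fg]; apply: contra qq' => /eqP[].
  by move=> /fi->.
by move=> /gi->.
Qed.

(** * Words linked by swaps and toggles *)

Lemma tperm_fix x y z q : x != y -> x != z -> (tperm y z q == x) = (q == x).
Proof. by move=> xy xz; rewrite -{1}(tpermD (x := y) (y := z)
  (z := x)) 1?eq_sym // (inj_eq perm_inj). Qed.

(** Generated by moves that preserve triviality once all swaps do; each move is an involution,
    whence symmetry. *)
Inductive linked w : seq (option Q) -> Prop :=
| linked_refl : linked w w
| linked_swap u y z : linked w u -> linked w (letterwise (tperm y z) u)
| linked_toggle u x y z : x != y -> x != z -> linked w u ->
    linked w (toggle x id (tperm y z) false u).

Lemma linked_trans u w v : linked w u -> linked u v -> linked w v.
Proof.
move=> wu; elim=> // t; first by move=> y z _; exact: linked_swap.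
by move=> x y z xy xz _; exact: linked_toggle.
Qed.

Lemma letterwise_tpermK y z : involutive (letterwise (tperm y z)).
Proof.
move=> w; rewrite /letterwise -map_comp -[RHS]map_id; apply: eq_map.
by case=> //= q; rewrite tpermK.
Qed.

Lemma toggle_tpermK x y z : x != y -> x != z ->
  involutive (toggle x id (tperm y z) false).
Proof.
move=> xy xz w; rewrite toggle_comp // => [|q]; last exact: tperm_fix.
rewrite (@eq_toggle _ _ id _ id) //; last by move=> q /=; rewrite tpermK.
by rewrite toggle_letterwise /letterwise -[RHS]map_id; apply: eq_map; case.
Qed.

Lemma linked_sym w u : linked w u -> linked u w.
Proof.
elim=> [|v y z _ vw|v x y z xy xz _ vw]; first exact: linked_refl.
  apply: linked_trans vw; rewrite -{2}[v](letterwise_tpermK y z).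
  exact/linked_swap/linked_refl.
apply: linked_trans vw; rewrite -{2}[v](toggle_tpermK xy xz).
exact/linked_toggle/linked_refl.
Qed.

Lemma linked_pattern w u : linked w u -> map isSome u = map isSome w.
Proof.
by elim=> // v *; rewrite ?letterwise_pattern ?toggle_pattern.
Qed.

Lemma linked_reduced w u : linked w u -> reduced w -> reduced u.
Proof.
move=> wu rw; elim: wu => // v y z; last first.
  move=> z' yz yz' _; apply: toggle_reduced => //; first exact: perm_inj.
  by rewrite tpermD // eq_sym.
move=> _; rewrite -(toggle_letterwise y _ false).
by apply: toggle_reduced => //; exact: perm_inj.
Qed.

(** Moves read from left to right, so their effect on a prefix is independent of what follows. *)
Lemma linked_cat w u : linked w u ->
  forall t, exists t', linked (w ++ t) (u ++ t').
Proof.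
move=> wu t; elim: wu => [|v y z _ [t' wv]|v x y z xy xz _ [t' wv]].
- by exists t; apply: linked_refl.
- exists (letterwise (tperm y z) t').
  by rewrite /letterwise -map_cat; apply: linked_swap.
- have [s e] := toggle_cat x id (tperm y z) false v t'.
  by exists (toggle x id (tperm y z) s t'); rewrite -e; apply: linked_toggle.
Qed.

Lemma linked_rcons w u l : linked w u ->
  exists2 l', isSome l' = isSome l & linked (rcons w l) (rcons u l').
Proof.
move=> wu; have [t wt] := linked_cat wu [:: l].
have := linked_pattern wt; rewrite !map_cat (linked_pattern wu) => /eqP.
rewrite eqseq_cat // eqxx /=; case: t wt => [|l' [|? ?]] wt /eqP // [e].
by exists l' => //; rewrite -!cats1.
Qed.

Lemma linked_rcons_some w u r : linked w u ->
  exists r', linked (rcons w (Some r)) (rcons u (Some r')).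
Proof. by case/(linked_rcons (Some r)) => -[r'|] // _; exists r'. Qed.

Lemma linked_rcons_none w u : linked w u ->
  linked (rcons w None) (rcons u None).
Proof. by case/(linked_rcons None) => -[r'|]. Qed.

Lemma toggle_negb x f g s w : toggle x f g (~~ s) w = toggle x g f s w.
Proof. by elim: w s => //= l w IH s; rewrite addNb IH; case: s. Qed.

Lemma letterwise_toggle_true x y z w :
  letterwise (tperm y z) (toggle x id (tperm y z) true w) =
  toggle x id (tperm y z) false w.
Proof.
rewrite letterwise_toggle (toggle_negb _ _ _ false).
by apply: eq_toggle => // q /=; rewrite tpermK.
Qed.

(** If the letter in front is [x], a toggle reaches the tail with its flag up; a further swap of [y]
    and [z] turns it into the toggle with flag down and fixes [x]. *)
Lemma linked_cons w u q : linked w u ->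
  exists q', linked (Some q :: w) (Some q' :: u).
Proof.
elim=> [|v y z _ [q' wv]|v x y z xy xz _ [q' wv]].
- by exists q; apply: linked_refl.
- by exists (tperm y z q'); apply: (linked_swap y z wv).
- exists q'; have := linked_toggle xy xz wv; rewrite /=.
  case: eqP => // -> /(linked_swap y z) /=.
  by rewrite letterwise_toggle_true tpermD // eq_sym.
Qed.

(** One injective [f] serves all [q]: a toggle needs the correcting swap exactly when the first
    letter is not [x], and the swap would fix [x], so in both cases the first letter moves by
    [tperm y z]. *)
Lemma linked_cons_none_cons w u : linked w u ->
  exists2 f : Q -> Q, injective f &
    forall q, linked (Some q :: None :: w) (Some (f q) :: None :: u).
Proof.
elim=> [|v y z _ [f fi wv]|v x y z xy xz _ [f fi wv]].
- by exists id => // q; apply: linked_refl.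
- exists (tperm y z \o f) => [|q]; first exact/inj_comp/fi/perm_inj.
  exact: (linked_swap y z (wv q)).
- exists (tperm y z \o f) => [|q]; first exact/inj_comp/fi/perm_inj.
  have := linked_toggle xy xz (wv q); rewrite /=.
  have [->|_] := eqVneq (f q) x; first by rewrite tpermD // eq_sym.
  by move=> /(linked_swap y z) /=; rewrite letterwise_toggle_true.
Qed.

Lemma linked_cons_none w u : linked w u -> linked (None :: w) (None :: u).
Proof.
elim=> [|v y z _ wv|v x y z xy xz _ wv]; first exact: linked_refl.
  exact: (linked_swap y z wv).
have /(linked_swap y z) := linked_toggle xy xz wv.
by rewrite /= letterwise_toggle_true.
Qed.

Definition spaced (p : seq bool) := sorted orb p.

Lemma reduced_spaced w : reduced w -> spaced (map isSome w).
Proof.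
rewrite /reduced /spaced sorted_map; apply: sub_sorted.
by move=> [a|] [b|].
Qed.

(** * Transitivity on reduced words of a given pattern *)

Section Representatives.
Variables x u v : Q.
Hypotheses (xu : x != u) (xv : x != v) (uv : u != v).

(* Every block of initial_word begins with its only x, so that toggle acts on
   all other letters: it coincides with a swap, and toggle followed by that swap
   moves only a letter put in front. *)
Fixpoint initial_word (l : option Q) (p : seq bool) : seq (option Q) :=
  match p with
  | [::] => [::]
  | false :: p' => None :: initial_word None p'
  | true :: p' =>
      let m := if l is Some q then if q == u then v else u else x in
      Some m :: initial_word (Some m) p'
  end.

Lemma initial_word_pattern l p : map isSome (initial_word l p) = p.
Proof. by elim: p l => [|[] p IH] l //=; rewrite IH. Qed.

Lemma initial_word_path l p : path orb (isSome l) p ->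
  path (fun a b => a != b) l (initial_word l p).
Proof.
elim: p l => [|[] p IH] l //= /andP[lt pp]; last first.
  by rewrite IH // andbT; case: l lt {pp}.
rewrite IH // andbT; case: l {lt pp} => // q.
have [->|qu] := eqVneq q u; first by apply: contra uv => /eqP[->].
by apply: contra qu => /eqP[->].
Qed.

Lemma initial_word_toggle l p y z : x != y -> x != z ->
    path orb (isSome l) p ->
  toggle x id (tperm y z) (isSome l) (initial_word l p) =
  letterwise (tperm y z) (initial_word l p).
Proof.
move=> xy xz; elim: p l => [|[] p IH] [q|] //= pp.
- set m := if _ then _ else _.
  have /negPf mx : m != x by rewrite /m; case: ifP => _; rewrite eq_sym.
  by congr (_ :: _); rewrite mx (IH (Some m)).
- by rewrite eqxx (IH (Some x)) // tpermD // eq_sym.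
- by rewrite (IH None).
Qed.

Definition starts_none (p : seq bool) := if p is e :: _ then ~~ e else false.

Definition final_letter (l : option Q) (p : seq bool) :=
  if starts_none p then x else if l == Some u then v else u.

Lemma final_letter_eq l p : (Some (final_letter l p) == Some x) = starts_none p.
Proof.
rewrite /final_letter (inj_eq Some_inj); case: ifP => _; first exact: eqxx.
by case: ifP => _; rewrite eq_sym; apply/negbTE.
Qed.

Lemma final_letter_neq l p : l != Some x -> l != Some (final_letter l p).
Proof.
rewrite /final_letter; case: ifP => // _ _.
by case: ifPn => [/eqP->|//]; rewrite (inj_eq Some_inj).
Qed.

(* Every block of final_word that is followed by None ends with its only x,
   which makes up for that None: toggle fixes the word, but not once Some q and
   None are put in front of it with q != x. *)
Fixpoint final_word (l : option Q) (p : seq bool) : seq (option Q) :=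
  match p with
  | [::] => [::]
  | false :: p' => None :: final_word None p'
  | true :: p' =>
      let m := Some (final_letter l p') in m :: final_word m p'
  end.

Lemma final_word_pattern l p : map isSome (final_word l p) = p.
Proof. by elim: p l => [|[] p IH] l //=; rewrite IH. Qed.

Lemma final_word_path l p : starts_none p = (l == Some x) ->
    path orb (isSome l) p ->
  path (fun a b => a != b) l (final_word l p).
Proof.
elim: p l => [|[] p IH] l //= sl /andP[lt pp].
  by rewrite IH ?final_letter_eq // andbT final_letter_neq // -[_ == _]sl.
by rewrite IH ?(eqP (esym sl)) //; case: p pp {IH} => [|[]].
Qed.

Lemma final_word_toggle l p t y z : x != y -> x != z ->
    starts_none p = (l == Some x) -> path orb (isSome l) p ->
  toggle x id (tperm y z) (l == Some x) (final_word l p ++ t) =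
  final_word l p ++ toggle x id (tperm y z) false t.
Proof.
move=> xy xz; elim: p l => [|[] p IH] l /= sl; first by rewrite -sl.
  move=> /andP[lt pp]; rewrite -sl /= -[_ == x](inj_eq Some_inj).
  by rewrite IH // final_letter_eq.
move=> /andP[lt pp]; rewrite -sl /= (IH None) //.
by case: p pp {IH} => [|[]].
Qed.

Lemma linked_initial_word q q' p : q != x -> q' != x -> path orb false p ->
  linked (Some q :: initial_word None p) (Some q' :: initial_word None p).
Proof.
rewrite eq_sym => qx; rewrite eq_sym => q'x pp.
have := linked_swap q q' (linked_toggle qx q'x
  (linked_refl (Some q :: initial_word None p))).
rewrite /= tpermL [q == x]eq_sym (negPf qx).
by rewrite (initial_word_toggle (l := None) qx q'x pp) letterwise_tpermK.
Qed.

(** The toggle of [q] and [q'] enters the tail with flag up; the swap reduces this to flag down,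
    which fixes [final_word] and leaves the flag down at [r]. *)
Lemma linked_final_word q q' p r : q != x -> q' != x ->
    ~~ starts_none p -> path orb false p ->
  linked (Some q :: None :: rcons (final_word None p) r)
         (Some q' :: None :: rcons (final_word None p) r).
Proof.
rewrite eq_sym => qx; rewrite eq_sym => q'x /negPf sp pp.
have := linked_swap q q' (linked_toggle qx q'x
  (linked_refl (Some q :: None :: rcons (final_word None p) r))).
rewrite /= tpermL [q == x]eq_sym (negPf qx) /= letterwise_toggle_true.
rewrite -cats1 (final_word_toggle (l := None) _ qx q'x sp pp).
by case: r => [r|].
Qed.

Lemma reduced_cons_none q w : path orb false (map isSome w) -> reduced w ->
  reduced (Some q :: None :: w).
Proof. by rewrite /reduced /=; case: w => [|[r|] w]. Qed.

Section Block.
Variables (n : nat) (p : seq bool).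
Hypothesis IH : forall w w', size w < n -> reduced w -> reduced w' ->
  map isSome w = map isSome w' -> linked w w'.
Hypothesis size_p : size p < n.-2.
Hypotheses (sp : ~~ starts_none p) (pp : path orb false p).

Let v0 := final_word None p.
Let F q r := Some q :: None :: rcons v0 (Some r).

Let v0_pattern : map isSome v0 = p.
Proof. exact: final_word_pattern. Qed.

Let v0_reduced : reduced v0.
Proof.
by apply: path_sorted (final_word_path (l := None) _ pp); apply/negbTE.
Qed.

Let linked_suffix w r r0 : reduced (rcons w (Some r)) ->
    reduced (rcons v0 (Some r0)) -> map isSome w = p ->
  exists2 f : Q -> Q, injective f &
    forall q, linked (Some q :: None :: rcons w (Some r)) (F (f q) r0).
Proof.
move=> rw rr0 pw; apply/linked_cons_none_cons/IH => //.
  by rewrite size_rcons -(size_map isSome) pw; move: size_p;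
    case: (n) => [|[|m]] //= /ltnW.
by rewrite !map_rcons pw v0_pattern.
Qed.

(* All q != x are equivalent in front of v0 and r0.  To reach q = x, change the
   last letter so that x becomes u, and come back to r0: this permutes the first
   letters by some f, and f u and f v are not both equal to x. *)
Let linked_x q r0 : reduced (rcons v0 (Some r0)) -> linked (F q r0) (F u r0).
Proof.
move=> rr0; have [->|qx] := eqVneq q x; last first.
  by apply: linked_final_word; rewrite // eq_sym.
have rF q' : reduced (F q' r0).
  apply: reduced_cons_none => //; rewrite map_rcons v0_pattern.
  by rewrite rcons_path pp orbT.
have rFv q' : reduced (Some q' :: None :: v0).
  by apply: reduced_cons_none => //; rewrite v0_pattern.
have [r1 xu1] : exists r1, linked (F x r0) (F u r1).
  apply/(@linked_rcons_some (_ :: _ :: _) (_ :: _ :: _))/IH; try exact: rFv;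
    last by [].
  by rewrite /= -(size_map isSome v0) v0_pattern; move: size_p;
    case: (n) => [|[|m]].
have rr1 : reduced (rcons v0 (Some r1)).
  by have /path_sorted/path_sorted := linked_reduced xu1 (rF x).
have [f fi fF] := linked_suffix rr1 rr0 v0_pattern.
have [y [yx fyx]] : exists y, y != x /\ f y != x.
  have [fu|] := eqVneq (f u) x; last by exists u; rewrite eq_sym.
  exists v; split; first by rewrite eq_sym.
  by rewrite -fu (inj_eq fi) eq_sym.
apply: (linked_trans xu1); apply: (@linked_trans (F y r1)).
  by apply: linked_final_word; rewrite // eq_sym.
apply: (linked_trans (fF y)).
by apply: linked_final_word; rewrite // eq_sym.
Qed.

(** By induction both tails are brought to [v0] followed by a common letter [r0], at the cost of
    changing the first letters, which [linked_x] then sends to [u]. *)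
Lemma linked_of_pattern_block q q' w w' r r' :
    reduced (rcons w (Some r)) -> reduced (rcons w' (Some r')) ->
    map isSome w = p -> map isSome w' = p ->
  linked (Some q :: None :: rcons w (Some r))
         (Some q' :: None :: rcons w' (Some r')).
Proof.
move=> rw rw' pw pw'.
have rw1 : reduced w by move: rw; rewrite /reduced -cats1 => /cat_sorted2[].
have [r0 wv0] : exists r0, linked (rcons w (Some r)) (rcons v0 (Some r0)).
  apply/linked_rcons_some/IH => //; last by rewrite pw v0_pattern.
  rewrite -(size_map isSome) pw; move: size_p; case: (n) => [|[|m]] //= h.
  exact/ltnW/ltnW.
have rr0 := linked_reduced wv0 rw.
have [f _ fF] := linked_suffix rw rr0 pw.
have [f' _ fF'] := linked_suffix rw' rr0 pw'.
apply: (linked_trans (fF q)); apply: linked_trans (linked_sym (fF' q')).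
exact: linked_trans (linked_x _ rr0) (linked_sym (linked_x _ rr0)).
Qed.

End Block.

(** Strong induction on the length. A leading [None] is removed; a first block of several letters is
    handled through [initial_word], a one-letter block through [final_word], unless the word ends in
    [None], which is removed. *)
Lemma linked_of_pattern w w' : reduced w -> reduced w' ->
  map isSome w = map isSome w' -> linked w w'.
Proof.
have [n] := ubnP (size w); elim: n w w' => // n IH.
have rb l w : reduced (l :: w) -> reduced w by move=> /path_sorted.
case=> [|[q|] w] [|[q'|] w'] sw rw rw' // => [_|[e]|[e]];
  first exact: linked_refl.
  2: by apply/linked_cons_none/IH => //; [exact: rb rw|exact: rb rw'].
have sze : size w' = size w by rewrite -(size_map isSome) -e size_map.
case: w w' e sw rw rw' sze => [|[p|] w] [|[p'|] w'] // e sw rw rw' sze.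
- have := linked_swap q q' (linked_refl [:: Some q]).
  by rewrite /= tpermL.
- have sp : path orb false (map isSome (Some p :: w)).
    exact: (reduced_spaced (rb _ _ rw)).
  pose w0 := initial_word None (map isSome (Some p :: w)).
  have rw0 : reduced w0.
    exact: path_sorted (initial_word_path (l := None) sp).
  have pw0 : map isSome w0 = map isSome (Some p :: w).
    exact: initial_word_pattern.
  have [q1 wq1] : exists q1, linked (Some q :: Some p :: w) (Some q1 :: w0).
    by apply: linked_cons; apply: IH => //; exact: rb rw.
  have [q2 wq2] : exists q2, linked (Some q' :: Some p' :: w') (Some q2 :: w0).
    apply: linked_cons; apply: IH; rewrite ?pw0 //; last exact: rb rw'.
    by rewrite sze.
  apply: (linked_trans wq1); apply: linked_trans (linked_sym wq2).
  (* The word [w0] starts with [x], so reducedness keeps the letters in front of it different from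
     [x]. *)
  apply: linked_initial_word => //.
    by have /andP[] := linked_reduced wq1 rw.
  by have /andP[] := linked_reduced wq2 rw'.
have {}e : map isSome w = map isSome w' by case: e.
case/lastP: w e sw rw sze => [|w [r|]] e sw rw sze.
- case: w' e {rw' sze} => // _.
  have := linked_swap q q' (linked_refl [:: Some q; None]).
  by rewrite /= tpermL.
- case/lastP: w' e rw' sze => [|w' l]; first by case: (w).
  rewrite !map_rcons => /rcons_inj[e]; case: l => // r' _ rw' sze.
  have /andP[pp _] : path orb false (map isSome w) &&
      (last false (map isSome w) || true).
    rewrite -rcons_path; have := reduced_spaced rw.
    by rewrite -[rcons _ true](map_rcons isSome w (Some r)).
  apply: (@linked_of_pattern_block n (map isSome w)) => //.
  + by move: sw; rewrite size_map /= size_rcons; case: (n) => [|[|m]].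
  + by case: (map _ _) pp => // -[].
  + exact/(rb None)/(rb (Some q)).
  + exact/(rb None)/(rb (Some q')).
- case/lastP: w' e rw' sze => [|w' l]; first by case: (w).
  rewrite !map_rcons => /rcons_inj[e]; case: l => // _ rw' sze.
  have rl t : reduced (rcons t None) -> reduced t.
    by rewrite /reduced -cats1 => /cat_sorted2[].
  apply: (@linked_rcons_none (_ :: _ :: _) (_ :: _ :: _)); apply: IH.
  + by move: sw; rewrite /= size_rcons.
  + exact: (rl (_ :: _ :: _)).
  + exact: (rl (_ :: _ :: _)).
  + by rewrite /= e.
Qed.

End Representatives.
End Words.

(** * Action on binary words and maps preserving triviality *)

Lemma iter_return (T : finType) (f : seq T -> seq T) (w : seq T) :
    injective f -> (forall w, size (f w) = size w) ->
  exists k, iter k f (f w) = w.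
Proof.
move=> f_inj f_size.
have fP (t : (size w).-tuple T) : size (f t) == size w.
  by rewrite f_size size_tuple.
pose F (t : (size w).-tuple T) := Tuple (fP t).
have F_inj : injective F by move=> s t /(congr1 val) /f_inj /val_inj.
have F_iter k (t : (size w).-tuple T) : val (iter k F t) = iter k f t.
  by elim: k => //= k ->.
(* The map permutes the finitely many words of this length; one application is already made, hence
   the predecessor of the order. *)
exists (fingraph.order F (in_tuple w)).-1; rewrite -iterSr orderSpred.
by rewrite -[in LHS](F_iter _ (in_tuple w)) iter_order.
Qed.

Section Dynamics.
Variables (Q : finType) (s : {perm Q}) (a b x : Q).
Hypotheses (xa : x != a) (xb : x != b).
Implicit Types (w : seq (option Q)).

Definition successor (l : option Q) (c : bool) : option Q :=
  omap (fun q => s (if c then tperm a b q else q)) l.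

Fixpoint act (l : option Q) (t : seq bool) : seq bool :=
  if t is c :: t' then c (+) active x l :: act (successor l c) t' else [::].

(** An active letter has the same successor on both inputs, since [tperm a b] fixes [x]; so the
    second pass visits the same states. *)
Lemma actK l : involutive (act l).
Proof.
move=> t; elim: t l => //= c t IH l; rewrite -addbA addbb addbF.
congr (_ :: _); rewrite -[RHS](IH (successor l c)); congr (act _ _).
case: l => //= q; have [->|_] := eqVneq q x; last by rewrite addbF.
by rewrite tpermD 1?eq_sym // !if_same.
Qed.

(* The leftmost letter acts first, whereas it acts last in a product of
   bijections: hence the reversal in prod_act_bij. *)
Definition word_act w (t : seq bool) := foldl (fun t l => act l t) t w.

(** The word of sections at [c]: the flag is the image of [c] under the letters to the left. *)
Definition dual (c : bool) w := toggle x s (s \o tperm a b) c w.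

Lemma word_act_cons w c t : word_act w (c :: t) =
  c (+) odd (count (active x) w) :: word_act (dual c w) t.
Proof.
elim: w c t => [|l w IH] c t; first by rewrite addbF.
rewrite /= -/(word_act w _) IH oddD oddb addbA;
  congr (_ :: word_act _ (act _ t)).
by case: l => //= q; case: c.
Qed.

Lemma dual_inj c : injective (dual c).
Proof.
move=> w w'; elim: w w' c => [|l w IH] [|l' w'] c //= [e].
have -> : l = l'.
  move: e; case: l l' => [q|] [q'|] //; case: c => /= -[] /perm_inj.
    by move/perm_inj=> ->.
  by move=> ->.
by move=> /IH ->.
Qed.

Lemma size_dual c w : size (dual c w) = size w.
Proof. by rewrite -(size_map isSome) toggle_pattern size_map. Qed.

Definition trivial w := forall t, word_act w t = t.

Lemma trivial_even w : trivial w -> ~~ odd (count (active x) w).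
Proof. by move=> tw; have := tw [:: false]; rewrite word_act_cons;
  case: (odd _). Qed.

Definition preserves_trivial (f : seq (option Q) -> seq (option Q)) :=
  forall w, trivial (f w) <-> trivial w.

(* The converse implication holds because dual c has finite order on words of a
   given length. *)
Lemma dual_invariant c : preserves_trivial (dual c).
Proof.
have fwd w : trivial w -> trivial (dual c w).
  by move=> tw t; have := tw (c :: t); rewrite word_act_cons => -[].
move=> w; split=> [tw|]; last exact: fwd.
have [k <-] := iter_return w (@dual_inj c) (size_dual c).
by elim: k => //= k; apply: fwd.
Qed.

Lemma invariant_pullback f g :
  (forall w, dual false (f w) = g (dual false w)) ->
  preserves_trivial g -> preserves_trivial f.
Proof.
move=> fg ig w; apply: iff_trans (dual_invariant false w).
by apply: iff_trans (iff_sym (dual_invariant false _)) _; rewrite fg.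
Qed.

Lemma dual_surj w : exists w', dual false w' = w.
Proof.
have [k e] := iter_return w (@dual_inj false) (size_dual false).
by exists (iter k (dual false) w); rewrite -[LHS]iterS iterSr.
Qed.

Lemma invariant_pushforward f g :
  (forall w, dual false (f w) = g (dual false w)) ->
  preserves_trivial f -> preserves_trivial g.
Proof.
move=> fg jf w; have [w' <-] := dual_surj w; rewrite -fg.
by apply: iff_trans (dual_invariant false _) _;
  apply: iff_trans (jf _) (iff_sym (dual_invariant false _)).
Qed.

Lemma invariant_comp f g : preserves_trivial f -> preserves_trivial g ->
  preserves_trivial (f \o g).
Proof. by move=> jf ig w; apply: iff_trans (jf _) (ig w). Qed.

Lemma eq_invariant f g : f =1 g -> preserves_trivial f -> preserves_trivial g.
Proof. by move=> fg jf w; rewrite -fg. Qed.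

Lemma letterwise_comp (f g : Q -> Q) w :
  letterwise f (letterwise g w) = letterwise (f \o g) w.
Proof. by rewrite /letterwise -map_comp; apply: eq_map; case. Qed.

Lemma eq_letterwise (f g : Q -> Q) : f =1 g -> letterwise f =1 letterwise g.
Proof. by move=> fg w; apply: eq_map => -[q|] //=; rewrite fg. Qed.

Definition swappable y z := preserves_trivial (letterwise (tperm y z)).

Lemma swappable_sym y z : swappable y z -> swappable z y.
Proof. by rewrite /swappable tpermC. Qed.

Lemma swappable_refl y : swappable y y.
Proof.
move=> w; rewrite tperm1 (@eq_letterwise _ id) => [|q]; last exact: perm1.
by rewrite /letterwise (eq_map (g := id)) ?map_id //; case.
Qed.

Lemma tperm_conj (u : {perm Q}) y z q :
  tperm (u y) (u z) (u q) = u (tperm y z q).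
Proof. by rewrite inj_tperm //; exact: perm_inj. Qed.

Lemma swappable_trans z y t : swappable y z -> swappable z t -> swappable y t.
Proof.
have [->|ty] := eqVneq t y; first by move=> *; apply: swappable_refl.
have [->//|tz] := eqVneq t z.
(* The transposition of [y] and [t] is that of [z] and [t] conjugated by that of [y] and [z]. *)
move=> yz zt; apply: (eq_invariant _ (invariant_comp yz
  (invariant_comp zt yz))) => w.
rewrite /= !letterwise_comp; apply: eq_letterwise => q /=.
have tE : tperm y z t = t by rewrite tpermD 1?eq_sym.
by rewrite -tperm_conj tpermK tpermR tE.
Qed.

Lemma dual_letterwise c f w : (forall q, (f q == x) = (q == x)) ->
  dual c (letterwise f w) = toggle x (s \o f) (s \o tperm a b \o f) c w.
Proof. exact: toggle_letterwise_comp. Qed.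

Lemma tperm_ab_fix q : (tperm a b q == x) = (q == x).
Proof. exact: tperm_fix. Qed.

(** This swap carries [dual false w] to [dual true w], and both duals preserve triviality. *)
Lemma swappable_sab : swappable (s a) (s b).
Proof.
move=> w; have [w' <-] := dual_surj w.
apply: iff_trans (iff_sym (dual_invariant false w')).
rewrite letterwise_toggle (@eq_toggle _ x _ (s \o tperm a b) _ s) => [|q|q] /=.
- by rewrite -toggle_negb; exact: dual_invariant.
- exact: tperm_conj.
- by rewrite tperm_conj tpermK.
Qed.

Lemma swappable_ab : swappable a b.
Proof.
apply: (invariant_pullback _ swappable_sab) => w.
rewrite dual_letterwise; last exact: tperm_ab_fix.
by rewrite letterwise_toggle; apply: eq_toggle => q /=; rewrite tperm_conj.
Qed.

(** Since [tperm y z] fixes [x] and commutes with [tperm a b], the map [dual false] intertwines it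
    with the swap of [s y] and [s z]. *)
Lemma swappable_s y z : y != a -> y != b -> y != x -> z != a -> z != b ->
    z != x -> swappable y z -> swappable (s y) (s z).
Proof.
move=> ya yb yx za zb zx; apply: invariant_pushforward => w.
rewrite dual_letterwise => [|q]; last by rewrite tperm_fix // eq_sym.
have yE : tperm a b y = y by rewrite tpermD 1?eq_sym.
have zE : tperm a b z = z by rewrite tpermD 1?eq_sym.
rewrite letterwise_toggle; apply: eq_toggle => q /=; rewrite tperm_conj //.
by rewrite -(tperm_conj (tperm a b)) yE zE.
Qed.

Definition split_swap z p q := toggle x (tperm z p) (tperm z q) false.

(* Pulling back the swap of s z and s a gives split_swap z a b, and conjugating
   it by swaps within {a, b, c} gives the other factors of the identity
   (z a) = split_swap z a b * split_swap z c b * split_swap z c a. *)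
Lemma swappable_of_s c z : uniq [:: a; b; c; z; x] -> swappable b c ->
  swappable (s z) (s a) -> swappable z a.
Proof.
move=> /and5P[]; rewrite !inE !negb_or.
case/and4P=> ab ac az ax /and3P[bc bz bx] /andP[cz cx] zx _ good_bc good_s.
have good_ab := swappable_ab; have good_ac := swappable_trans good_ab good_bc.
have split_ab : preserves_trivial (split_swap z a b).
  apply: (invariant_pullback _ good_s) => w.
  rewrite /dual /split_swap toggle_comp => [|q|q]; last 2 first.
  - by rewrite tperm_fix // eq_sym.
  - by rewrite tperm_fix // eq_sym.
  rewrite letterwise_toggle; apply: eq_toggle => q /=; rewrite tperm_conj //.
  have zE : tperm a b z = z by rewrite tpermD.
  by rewrite -(tperm_conj (tperm a b)) zE tpermR.
have split_conj y t p q : swappable y t -> y != z -> t != z -> y != x ->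
    t != x -> preserves_trivial (split_swap z p q) ->
  preserves_trivial (split_swap z (tperm y t p) (tperm y t q)).
  move=> good_yt yz tz yx tx h.
  apply: (eq_invariant _ (invariant_comp good_yt
    (invariant_comp h good_yt))) => w /=.
  rewrite /split_swap (@toggle_letterwise_comp _ x x) => [|r];
    last by rewrite tperm_fix // eq_sym.
  have zE : z = tperm y t z by rewrite tpermD.
  rewrite letterwise_toggle; apply: eq_toggle => r /=;
    by rewrite -tperm_conj tpermK -zE.
have split_cb : preserves_trivial (split_swap z c b).
  have := split_conj a c a b good_ac az cz ax cx split_ab.
  by rewrite tpermL tpermD // eq_sym.
have split_ca : preserves_trivial (split_swap z c a).
  have := split_conj a b c b good_ab az bz ax bx split_cb.
  by rewrite tpermR tpermD.
apply: (eq_invariant _ (invariant_comp split_ab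
  (invariant_comp split_cb split_ca))) => w.
rewrite /= /split_swap !toggle_comp => [|q|q|q|q]; try by apply: tperm_fix;
  rewrite 1?eq_sym.
rewrite -(toggle_letterwise x _ false).
by apply: eq_toggle => q /=; rewrite tpermK.
Qed.

(** * Nontriviality of reduced words when all swaps preserve triviality *)

Section AllSwappable.
Hypothesis ab : a != b.
Hypothesis swappable_all : forall y z, swappable y z.

Lemma letterwise_invariant (u : {perm Q}) : preserves_trivial (letterwise u).
Proof.
have [ts -> _] := prod_tpermP u; elim: ts => [|t ts IH].
  apply: (eq_invariant _ (swappable_refl a)); apply: eq_letterwise => q.
  by rewrite big_nil tperm1.
apply: (eq_invariant _ (invariant_comp IH (swappable_all t.1 t.2))) => w.
rewrite /= letterwise_comp; apply: eq_letterwise => q.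
by rewrite big_cons permM.
Qed.

(** The map [dual false] is this toggle followed by [s] on all letters. *)
Lemma toggle_ab_invariant : preserves_trivial (toggle x id (tperm a b) false).
Proof.
move=> w; apply: iff_trans (dual_invariant false w).
apply: iff_trans (iff_sym (letterwise_invariant s _)) _.
by rewrite letterwise_toggle.
Qed.

(** Transpositions put the images of [x], [a], [b] in place in turn, each fixing those already
    placed. *)
Lemma perm_triple x' y z : x' != y -> x' != z -> y != z ->
  exists u : {perm Q}, [/\ u x = x', u a = y & u b = z].
Proof.
move=> xy xz yz; pose u1 := tperm x x'.
pose u2 := tperm (u1 a) y; pose u3 := tperm (u2 (u1 b)) z.
have u1x : u1 x = x' by rewrite tpermL.
have u2x : u2 x' = x'.
  by rewrite tpermD // 1?eq_sym // -u1x (inj_eq perm_inj).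
have u2a : u2 (u1 a) = y by rewrite tpermL.
exists (u1 * u2 * u3)%g; rewrite !permM; split.
- by rewrite u1x u2x tpermD // 1?eq_sym // -[x']u2x -u1x !(inj_eq perm_inj).
- by rewrite u2a tpermD // 1?eq_sym // -u2a !(inj_eq perm_inj).
- by rewrite tpermL.
Qed.

(** A permutation taking [x], [a], [b] to [x'], [y], [z] conjugates the toggle of [a] and [b] into
    this one. *)
Lemma toggle_invariant x' y z : x' != y -> x' != z ->
  preserves_trivial (toggle x' id (tperm y z) false).
Proof.
move=> xy xz; have [<-|yz] := eqVneq y z.
  apply: (eq_invariant _ (swappable_refl y)) => w.
  rewrite -(toggle_letterwise x' _ false).
  by apply: eq_toggle => q /=; rewrite tperm1 perm1.
have [u [ux ua ub]] := perm_triple xy xz yz.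
apply: (eq_invariant _ (invariant_comp (letterwise_invariant u)
  (invariant_comp toggle_ab_invariant (letterwise_invariant u^-1)))) => w /=.
rewrite (@toggle_letterwise_comp _ x x') => [|q]; last first.
  by rewrite -(inj_eq (@perm_inj _ u)) permKV ux.
rewrite letterwise_toggle; apply: eq_toggle => q /=; first by rewrite permKV.
by rewrite -tperm_conj permKV ua ub.
Qed.

Lemma trivial_linked w w' : linked w w' -> trivial w -> trivial w'.
Proof.
move=> ww' tw; elim: ww' => // [t y z _|t x' y z xy xz _];
  first by move/(swappable_all y z).
by move/(toggle_invariant xy xz).
Qed.

(** Provides two reduced words of one pattern whose numbers of active letters have opposite
    parity. *)
Lemma reduced_branch q w : reduced (Some q :: w) ->
  exists w' y, [/\ y != x, map isSome w' = map isSome w,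
    reduced (Some x :: w') & reduced (Some y :: w')].
Proof.
move=> rw; have {rw} : reduced w by exact: path_sorted rw.
case: w => [|[r|] w] rw.
- by exists [::], a; rewrite eq_sym.
- have [rx|rx] := eqVneq r x.
    (* Once the tail starts with [a] instead of [x], both [x] and [b] may precede it. *)
    have rw' := linked_reduced (linked_swap x a (linked_refl _)) rw.
    exists (letterwise (tperm x a) (Some r :: w)), b.
    rewrite letterwise_pattern rx [b == x]eq_sym.
    move: rw'; rewrite rx /reduced /= tpermL !(inj_eq Some_inj).
    by rewrite xa [b == a]eq_sym ab.
  exists (Some r :: w), (if r == a then b else a).
  move: rw; rewrite /reduced /= !(inj_eq Some_inj) [x == r]eq_sym rx => ->.
  have [->|ra] := eqVneq r a; split=> //; rewrite ?andbT 1?eq_sym //.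
- by exists (None :: w), a; split=> //; rewrite eq_sym.
Qed.

Lemma reduced_nontrivial w : reduced w -> trivial w -> w = [::].
Proof.
move=> rw tw.
have even w' : reduced w' -> map isSome w' = map isSome w ->
    ~~ odd (count (active x) w').
  move=> rw' e; apply/trivial_even/(trivial_linked _ tw).
  exact: (linked_of_pattern xa xb ab).
case: w rw tw even => [|[q|] w] // rw _ even.
  have [w' [y [/negPf yx pw /even rx /even ry]]] := reduced_branch rw.
  by move: rx ry; rewrite /= !pw eqxx yx => /(_ erefl) /= /negPn -> /(_ erefl).
(* A leading [None] is kept and the parity argument is applied behind it. *)
case: w rw even => [|[q|] w] // rw even;
  first by have := even [:: None] erefl erefl.
have {}rw : reduced (Some q :: w) by exact: path_sorted rw.
have [w' [y [/negPf yx pw rx ry]]] := reduced_branch rw.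
have := even (None :: Some x :: w'); have := even (None :: Some y :: w').
by rewrite /= !pw eqxx yx => /(_ ry erefl) /= /negPn + /(_ rx erefl) /= => ->.
Qed.

End AllSwappable.
End Dynamics.

(** * All swaps preserve triviality for the rotation *)

Section Cycle.
Variable m : nat.
Hypothesis m_neq1 : m != 1.

Local Notation Q := 'I_m.+3.

Definition rotation : {perm Q} := perm (@ordS_inj m.+3).
Definition toggler : Q := inord (if m == 0 then 2 else 3).

Let num (k : nat) : Q := inord k.

Lemma num_eq i j : i < m.+3 -> j < m.+3 -> (num i == num j) = (i == j).
Proof. by move=> im jm; rewrite -val_eqE /= !inordK. Qed.

Lemma rotation_num k : k.+1 < m.+3 -> rotation (num k) = num k.+1.
Proof.
by move=> km; apply: val_inj; rewrite permE /= !inordK ?modn_small // ltnW.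
Qed.

Lemma rotation_last : rotation (num m.+2) = num 0.
Proof. by apply: val_inj; rewrite permE /= !inordK // modnn. Qed.

Lemma toggler_neq0 : toggler != num 0.
Proof. by rewrite num_eq //; case: (m) m_neq1 => [|[]]. Qed.

Lemma toggler_neq1 : toggler != num 1.
Proof. by rewrite num_eq //; case: (m) m_neq1 => [|[]]. Qed.

Lemma num0_neq1 : num 0 != num 1.
Proof. by rewrite num_eq. Qed.

Lemma swappable_rotation (y z : Q) :
  swappable rotation (num 0) (num 1) toggler y z.
Proof.
pose good := swappable rotation (num 0) (num 1) toggler.
have trans u v w : good u v -> good v w -> good u w by exact: swappable_trans.
have sym u v : good u v -> good v u by exact: swappable_sym.
have good01 : good (num 0) (num 1).
  exact: swappable_ab toggler_neq0 toggler_neq1.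
have good12 : good (num 1) (num 2).
  rewrite -(rotation_num (k := 1)) // -{1}(rotation_num (k := 0)) //.
  exact: swappable_sab.
have good02 := trans _ _ _ good01 good12.
suff good0 k : k < m.+3 -> good (num k) (num 0).
  rewrite -(inord_val y) -(inord_val z).
  by apply: (trans _ (num 0)); [|apply: sym]; apply: good0.
have [m0|m_gt1] : m = 0 \/ 1 < m.
- by case: (m) m_neq1 => [|[|?]]; auto.
- rewrite m0; case: k => [|[|[|]]] // _; first exact: swappable_refl.
    exact: sym good01.
  exact: sym good02.
have togglerE : toggler = num 3 by rewrite /toggler -if_neg -lt0n ltnW.
(* As [rotation] takes 0 to 1, the swap of the next state with 1 pulls back to the swap of [i] with
   0. *)
have good_down i : 3 < i < m.+3 -> good (rotation (num i)) (num 1) ->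
    good (num i) (num 0).
  case/andP=> i3 im; rewrite -{1}(rotation_num (k := 0)) // => hi.
  apply: (swappable_of_s toggler_neq0 toggler_neq1 (c := num 2)) => //.
  by rewrite togglerE /= !inE !num_eq; lia.
(* Induction downwards from the last state, which [rotation] takes to 0, to the state 4. *)
have good_top j : j + 4 <= m.+2 -> good (num (m.+2 - j)) (num 0).
  elim: j => [|j IH] jm.
    by rewrite subn0; apply: good_down; [lia|rewrite rotation_last].
  apply: good_down; first lia.
  rewrite rotation_num; last lia.
  have -> : (m.+2 - j.+1).+1 = m.+2 - j by lia.
  by apply: trans good01; apply: IH; lia.
have good_high i : 3 < i < m.+3 -> good (num i) (num 0).
  move=> hi; have -> : i = m.+2 - (m.+2 - i) by lia.
  by apply: good_top; lia.
case: k => [|[|[|[|k]]]] km; last exact: good_high.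
- exact: swappable_refl.
- exact: sym good01.
- exact: sym good02.
(* The states 3 and 0 are the rotations of 2 and of the last state, which lies above 3 because
   [1 < m]. *)
rewrite -(rotation_num (k := 2)) // -rotation_last.
apply: swappable_s; rewrite ?togglerE ?num_eq //; try lia.
by rewrite -togglerE; apply/sym/(trans _ _ _ _ good02)/good_high; lia.
Qed.

Lemma rotation_nontrivial (w : seq (option Q)) : reduced w ->
  trivial rotation (num 0) (num 1) toggler w -> w = [::].
Proof.
apply: reduced_nontrivial; [exact: toggler_neq0|exact: toggler_neq1| |].
  exact: num0_neq1.
exact: swappable_rotation.
Qed.

End Cycle.

(** * The automata and their transformation groups *)

Section Automata.
Variables (Q : finType) (s : {perm Q}) (a b x : Q).
Hypotheses (xa : x != a) (xb : x != b).
Hypothesis nontrivial : forall w : seq (option Q),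
  reduced w -> trivial s a b x w -> w = [::].

Definition act_bij (l : option Q) : bijection (seq bool) :=
  Bijection (actK s xa xb l) (actK s xa xb l).

Lemma act_bijK l : (act_bij l * act_bij l)%g = 1%g.
Proof. by apply: bij_ext => t; exact: actK. Qed.

Lemma prod_act_bij (w : seq (option Q)) t :
  (\prod_(l <- w) act_bij l)%g t = word_act s a b x (rev w) t.
Proof.
elim: w t => [|l w IH] t; first by rewrite big_nil.
by rewrite big_cons rev_cons /word_act foldl_rcons -/(word_act _ _ _ _ _ _) -IH.
Qed.

Lemma act_bij_free (w : seq (option Q)) : sorted (fun l l' => l != l') w ->
  (\prod_(l <- w) act_bij l)%g = 1%g -> w = [::].
Proof.
move=> rw w1; apply: (can_inj revK); apply: nontrivial => [|t].
  by rewrite /reduced rev_sorted; apply: sub_sorted rw => l l'; rewrite eq_sym.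
by rewrite -prod_act_bij w1.
Qed.

Lemma transformation_groupE (P : Type) (Y : automaton P bool)
    (g : P -> bijection (seq bool)) : (forall q, g q =1 transformation Y q) ->
  transformation_group Y = generated (range g).
Proof.
move=> gE; congr generated; apply/seteqP; split=> f.
  by case=> q fE; exists q => //; apply: bij_ext => t; rewrite gE fE.
by case=> q _ <-; exists q.
Qed.

Lemma invertible_bij (P : Type) (Y : automaton P bool)
    (g : P -> bijection (seq bool)) : (forall q, g q =1 transformation Y q) ->
  invertible Y.
Proof.
move=> gE q; apply: eq_bij (gE q).
by exists (bij_inv (g q)); [exact: bij_funK|exact: bij_invK].
Qed.

Definition involution_automaton : automaton Q bool :=
  Automaton (inhabits x) (inhabits true)
    (fun q c => s (if c then tperm a b q else q)) (fun q c => c (+) (q == x)).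

Definition involution_automaton_option : automaton (option Q) bool :=
  Automaton (inhabits None) (inhabits true)
    (successor s a b) (fun l c => c (+) active x l).

(** Negating the output applies h after b_q while the states evolve as before, so the state [q]
    realizes h b_q. *)
Definition flipped_automaton : automaton Q bool :=
  Automaton (inhabits x) (inhabits true)
    (fun q c => s (if c then tperm a b q else q))
    (fun q c => ~~ (c (+) (q == x))).

Lemma involution_automatonE q : act_bij (Some q) =1 transformation involution_automaton q.
Proof. by move=> t; elim: t q => //= c t IH q; congr cons; exact: IH. Qed.

Lemma involution_automaton_optionE l :
  act_bij l =1 transformation involution_automaton_option l.
Proof. by move=> t; elim: t l => //= c t IH l; congr cons; exact: IH. Qed.

Lemma flipped_automatonE q :
  (act_bij None * act_bij (Some q))%g =1 transformation flipped_automaton q.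
Proof. by move=> t; elim: t q => //= c t IH q; rewrite addbT; congr cons;
  exact: IH. Qed.

End Automata.

Theorem corollary1p7 :
  (forall n : nat, n = 3 \/ n = 5 \/ 7 <= n ->
     exists (Q : finType) (Y : automaton Q bool),
       [/\ #|Q| = n, invertible Y
         & free_on_generators (transformation_group Y) n])
  /\
  (forall n : nat, 3 <= n ->
     exists (Q : finType) (Y : automaton Q bool),
       [/\ #|Q| = n, invertible Y
         & freely_generated_by_involutions (transformation_group Y) n]).
Proof.
split=> [n hn|n n3].
  have [m -> m1] : exists2 m, n = m.+3 & m != 1.
    by exists n.-2.-1; lia.
  pose g q := (act_bij (rotation m) (toggler_neq0 m1) (toggler_neq1 m1) None *
    act_bij (rotation m) (toggler_neq0 m1) (toggler_neq1 m1) (Some q))%g.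
  have gE := flipped_automatonE (rotation m) (toggler_neq0 m1)
    (toggler_neq1 m1).
  exists 'I_m.+3, (flipped_automaton (rotation m) (inord 0) (inord 1)
    (toggler m)).
  split; [exact: card_ord|exact: invertible_bij gE|exists g].
  rewrite (transformation_groupE gE); apply: free_basis_from_involutions.
    exact: act_bijK.
  exact/act_bij_free/rotation_nontrivial.
have [->|n4] := eqVneq n 4.
  have gE := involution_automaton_optionE (rotation 0) (@toggler_neq0 0 isT)
    (@toggler_neq1 0 isT).
  have card4 : #|{: option 'I_3}| = 4 by rewrite card_option card_ord.
  exists (option 'I_3), (involution_automaton_option (rotation 0) (inord 0)
    (inord 1) (toggler 0)).
  split; [exact: card4|exact: invertible_bij gE|rewrite
    (transformation_groupE gE)].
  rewrite -card4; apply: (freely_generated_of_free (enum_val_bij _)).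
    exact: act_bijK.
  exact/act_bij_free/rotation_nontrivial.
have [m -> m1] : exists2 m, n = m.+3 & m != 1 by exists n.-2.-1; lia.
have gE := involution_automatonE (rotation m) (toggler_neq0 m1) (toggler_neq1 m1).
exists 'I_m.+3, (involution_automaton (rotation m) (inord 0) (inord 1) (toggler m)).
split; [exact: card_ord|exact: invertible_bij gE|rewrite
  (transformation_groupE gE)].
apply: (freely_generated_of_free (f := id)).
- by exists id.
- by move=> i; exact: act_bijK.
(* A relation among the b_q alone is a relation of the larger family in which [None] does not
   occur. *)
move=> w rw w1; apply: (inj_map Some_inj).
apply: (@act_bij_free _ _ _ _ _ (toggler_neq0 m1) (toggler_neq1 m1)).
- exact: rotation_nontrivial.
- by rewrite sorted_map.
- by rewrite big_map.
Qed.
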